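(* Let $X$ be an $e$-open space. Fix a metric $\rho$ on $X$. Then for any $\epsilon>0$ there is a $\delta>0$ such that, whenever $(Y,Z)$ is a space pair and $\phi$ is a map from $Z$ to $X$ with $\operatorname{diam}(\phi(Z))<\delta$, $\phi$ extends to a map $\bar\phi:Y\to X$ with $\operatorname{diam}(\bar\phi(Y))<\epsilon$. (The $\delta$ depends only on $X$, $\rho$, and $\epsilon$, not on $Y$ or $Z$.)
   Context: ''Space'' means compact metrizable space and ''map'' means continuous function. A metric on a space means a metric inducing its topology, and diameters of subsets of $X$ are taken with respect to $\rho$. A space pair is a pair $(Y,Z)$ where $Y$ is a space and $Z\subseteq Y$ is a closed subspace. For spaces $X,Z$, $X^Z$ denotes the set of maps from $Z$ to $X$ with the topology of uniform convergence (equivalently, the compact-open topology). For a space pair $(Y,Z)$, $X^{Z\uparrow Y}\subseteq X^Z$ denotes the set of maps from $Z$ to $X$ which extend to a map from $Y$ to $X$. A space $X$ is $e$-open if, for every space pair $(Y,Z)$, the set $X^{Z\uparrow Y}$ is open in $X^Z$. *)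

(* Defs.v *)
From HB Require Import structures.
From mathcomp Require Import all_boot all_order all_algebra.
From mathcomp Require Import all_classical all_reals all_analysis.

Set Implicit Arguments.
Unset Strict Implicit.
Unset Printing Implicit Defensive.

Local Open Scope classical_set_scope.
Local Open Scope ring_scope.

(* Compact metrizable spaces are rendered as compact inhabitants of            *)
(* [metricType R]; outside of [diam], only the underlying topology is used.    *)
(* A closed subspace [Z : set Y] is used as a topological space in its own     *)
(* right through the coercion to [set_type Z], which carries the topology      *)
(* initial for the inclusion [val : Z -> Y].                                   *)
Definition space_pair (R : realType) (Y : metricType R) (Z : set Y) : Prop :=
  compact [set: Y] /\ closed Z.

(* X^Z: on a compact Z and for metrizable X, the compact-open topology is the  *)
(* topology of uniform convergence for any compatible metric on X.             *)
Definition map_space (Z X : topologicalType) : topologicalType :=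
  initial_topology (id : continuousType Z X -> {compact-open, Z -> X}).

Definition extends (Y X : topologicalType) (Z : set Y)
    (g : continuousType Y X) (f : continuousType Z X) : Prop :=
  forall z : Z, g (val z) = f z.

Definition extendable_maps (Y X : topologicalType) (Z : set Y) :
    set (map_space Z X) :=
  [set f : continuousType Z X | exists g : continuousType Y X, extends g f].

Definition e_open (R : realType) (X : topologicalType) : Prop :=
  forall (Y : metricType R) (Z : set Y),
    space_pair Z -> open (@extendable_maps Y X Z).

(* The diameter of the empty set is -oo here, hence below every delta > 0,     *)
(* just as under the convention that it is 0.                                  *)
Definition diam (R : realType) (X : metricType R) (A : set X) : \bar R :=
  ereal_sup [set (mdist p.1 p.2)%:E | p in A `*` A].

(* Main.v *)
Require Import Defs.
From HB Require Import structures.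
From mathcomp Require Import all_boot all_order all_algebra.
From mathcomp Require Import all_classical all_reals all_analysis.
From mathcomp Require Import lra.

(** The heart of the matter is local: for a point x of X and eta > 0, every map
phi from Z to X with values close enough to x extends to Y with values within
eta of x ([e_open_small_extension]); how close must not depend on (Y, Z).

Suppose that no bound works.  Then for every n there is a bad pair (Y_n, Z_n)
with a map phi_n whose values are within 1/(n+1) of x.  All these pairs are
packed into a single one: let W be the disjoint union of the Y_n together with
an apex to which the pieces Y_n converge, that is, the one-point
compactification of the union with a metric in which the n-th piece shrinks to
the apex, and let Z consist of the apex and all the Z_n.  Let f_N be x at the
apex and on the Z_n with n < N, and phi_n on the Z_n with n >= N.  Each f_N is
continuous because the phi_n tend to x ([null_glue_continuous]), and f_N
converges to the constant map x as N grows ([cvg_const_map_space]).  The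
constant map extends to W; as the extendable maps form an open set, some f_N
extends to a map G on W.  By continuity of G at the apex, G is within eta of x
on all but finitely many pieces, so for large n the restriction of G to Y_n is a
small extension of phi_n, which is the contradiction.

The bound obtained at x also serves, once halved, at the points near x, so
compactness of X provides a bound that serves at all points simultaneously.  A
map of diameter less than that bound takes its values close to any one of them,
which reduces the theorem to the local statement with eta = epsilon / 4. *)

Import Order.TTheory GRing.Theory Num.Theory.
Import metricType_numDomainType.

Local Open Scope classical_set_scope.
Local Open Scope ring_scope.

(** * The null union of a sequence of metric spaces *)

(** The disjoint union with one point added, under a name of its own so that it
can carry the metric defined below, for which the pieces converge to [None]. *)
Definition null_union {R : realType} (Y : nat -> metricType R) : Type :=
  option {n & Y n}.

Section null_union_metric.
Context {R : realType} (Y : nat -> metricType R).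
Local Notation W := (null_union Y).

Definition apex : W := None.
Definition piece {n : nat} (y : Y n) : W := Some (existT _ n y).

(* The weight of the n-th piece: its distance to the apex. *)
Let w (n : nat) : R := n.+1%:R^-1.

Let fiber (p : W) : option nat := omap (@projT1 _ _) p.
Let rad (p : W) : R := if fiber p is Some n then w n else 0.

(** The original distance on each piece is truncated at the weight of the piece,
so that the pieces shrink without rescaling; points on different fibers are as
far apart as the larger of their distances to the apex. *)
Definition null_union_dist (p q : W) : R :=
  match p, q with
  | Some (existT n y), Some (existT m z) =>
      if @eqP _ n m is ReflectT e
      then Num.min (w m) (mdist (ecast i (Y i) e y) z)
      else Num.max (rad p) (rad q)
  | _, _ => Num.max (rad p) (rad q)
  end.
Local Notation dist := null_union_dist.

Variant same_fiber_spec : W -> W -> Prop :=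
  | SameApex : same_fiber_spec apex apex
  | SamePiece n (y z : Y n) : same_fiber_spec (piece y) (piece z).

Let same_fiberP p q : fiber p = fiber q -> same_fiber_spec p q.
Proof.
case: p q => [[n y]|] [[m z]|] //=; last by constructor.
by move=> [e]; case: _ / e z => z; exact: SamePiece.
Qed.

Let w_gt0 n : 0 < w n. Proof. by rewrite /w invr_gt0. Qed.

Let rad_ge0 p : 0 <= rad p.
Proof. by rewrite /rad; case: fiber => // n; exact: ltW. Qed.

Let dist_piece n (y z : Y n) :
  dist (piece y) (piece z) = Num.min (w n) (mdist y z).
Proof. by rewrite /dist/=; case: eqP => // e; rewrite eq_axiomK. Qed.

Let dist_fiber p q : fiber p != fiber q -> dist p q = Num.max (rad p) (rad q).
Proof.
case: p q => [[n y]|] [[m z]|] //= nm; rewrite /dist; case: eqP => // e.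
by case/eqP: nm; congr Some.
Qed.

Let dist_apex p : dist apex p = rad p.
Proof.
have -> : dist apex p = Num.max 0 (rad p) by [].
by rewrite max_r.
Qed.

Let dist_ge0 p q : 0 <= dist p q.
Proof.
have [/same_fiberP[|n y z]|/dist_fiber->] := eqVneq (fiber p) (fiber q).
- by rewrite dist_apex.
- by rewrite dist_piece le_min mdist_ge0 ltW.
- by rewrite le_max rad_ge0.
Qed.

Let dist_le_rad p q : dist p q <= Num.max (rad p) (rad q).
Proof.
have [/same_fiberP[|n y z]|/dist_fiber->//] := eqVneq (fiber p) (fiber q).
- by rewrite dist_apex le_max lexx.
- by rewrite dist_piece le_max ge_min lexx.
Qed.

Let dist_xx p : dist p p = 0.
Proof.
case: p => [[n y]|]; last by rewrite dist_apex.
by rewrite (dist_piece n y y) mdistxx min_r // ltW.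
Qed.

Let dist_eq0 p q : dist p q = 0 -> p = q.
Proof.
have [/same_fiberP[//|n y z]|pq] := eqVneq (fiber p) (fiber q).
- rewrite dist_piece; have := w_gt0 n.
  case: (leP (w n) (mdist y z)) => [_ /[swap]->|_ _ /mdist_positivity->//].
  by rewrite ltxx.
- have rad_le0 r : rad r <= 0 -> fiber r = None.
    by rewrite /rad; case: fiber => // n; rewrite leNgt w_gt0.
  rewrite dist_fiber// => m0; move: pq.
  by rewrite !rad_le0 ?eqxx // -m0 le_max lexx ?orbT.
Qed.

Let dist_sym p q : dist p q = dist q p.
Proof.
have [/same_fiberP[//|n y z]|pq] := eqVneq (fiber p) (fiber q).
- by rewrite !dist_piece metric_sym.
- by rewrite (dist_fiber _ _ pq) maxC -dist_fiber 1?eq_sym.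
Qed.

(* Within one piece this is the triangle inequality of a truncated distance.
Otherwise one of the two terms on the right is a maximum of distances to the
apex, and bounds the left-hand side as in an ultrametric space. *)
Let dist_triangle q p r : dist p r <= dist p q + dist q r.
Proof.
have [pq|pq] := eqVneq (fiber p) (fiber q); last first.
  rewrite (dist_fiber _ _ pq) (le_trans (dist_le_rad _ _))//.
  have [qr|/dist_fiber->] := eqVneq (fiber q) (fiber r).
    by rewrite /rad qr lerDl.
  rewrite ge_max; apply/andP; split; [apply: ler_wpDr|apply: ler_wpDl];
    by rewrite le_max ?lexx ?rad_ge0 ?orbT.
have [qr|qr] := eqVneq (fiber q) (fiber r); last first.
  rewrite (dist_fiber _ _ qr) (le_trans (dist_le_rad _ _))//.
  by rewrite /rad pq lerDr.
case: (same_fiberP _ _ pq) qr => [_|n y z]; first by rewrite dist_xx add0r.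
case: r => [[m u]|//] [e]; case: _ / e u => u.
rewrite !(dist_piece n).
case: (leP (w n) (mdist y z)) => [_|yz].
  by rewrite ge_min lerDl le_min mdist_ge0 ltW.
case: (leP (w n) (mdist z u)) => [_|zu].
  by rewrite ge_min lerDr mdist_ge0.
by rewrite ge_min metric_triangle orbT.
Qed.

HB.instance Definition _ := Choice.on W.
HB.instance Definition _ :=
  @isMetric.Build R W dist dist_xx dist_eq0 dist_sym dist_triangle.

Lemma mdist_piece n (y z : Y n) :
  mdist (piece y) (piece z) = Num.min n.+1%:R^-1 (mdist y z).
Proof. exact: dist_piece. Qed.

Lemma mdist_apex_piece n (y : Y n) : mdist apex (piece y) = n.+1%:R^-1.
Proof. exact: dist_apex. Qed.

(** Each piece is open and carries its original topology: leaving the piece of y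
costs at least its weight, and below the weight the truncation is invisible. *)
Lemma near_piece n (y : Y n) (e : R) (p : W) :
  e <= n.+1%:R^-1 -> mdist (piece y) p < e ->
  exists2 z : Y n, p = piece z & mdist y z < e.
Proof.
move=> en; have [/esym npE|np] := eqVneq (fiber p) (Some n).
  case: p npE => [[m z]|//] [nm]; case: _ / nm z => z.
  rewrite [mdist _ _](dist_piece n) gt_min.
  by rewrite ltNge en/= => ?; exists z.
rewrite [mdist _ _]dist_fiber 1?eq_sym// gt_max => /andP[+ _].
by rewrite ltNge en.
Qed.
End null_union_metric.

(** * Compactness, closed subsets and maps of a null union *)
Section null_union_topology.
Context {R : realType} (Y : nat -> metricType R).
Local Notation W := (null_union Y).

Lemma piece_continuous n : continuous (@piece _ Y n).
Proof.
move=> y; apply/cvgrPdist_lt => e e0.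
have : \forall z \near y, mdist y z < e by exact: (@cvgr_dist_lt _ _ _ _ _ id).
by apply: filterS => z yz; rewrite mdist_piece gt_min yz orbT.
Qed.

Lemma nbhs_apex (U : set W) : nbhs (apex Y) U ->
  \forall n \near \oo, forall y : Y n, U (piece Y y).
Proof.
move=> /nbhs_mdistP[e /= e0 eU].
near=> n => y; apply: eU; rewrite /= mdist_apex_piece.
by near: n; exact: near_infty_natSinv_lt (PosNum e0).
Unshelve. all: by end_near. Qed.

(** A neighbourhood of the apex misses only finitely many pieces, and finitely
many compact pieces have a compact union. *)
Lemma null_union_compact :
  (forall n, compact [set: Y n]) -> compact [set: W].
Proof.
move=> cY; apply/compact_near_coveringP => I F P FF cov.
have [[U V] /= [nU FV] UV] := cov (apex Y) Logic.I.
have [N _ NU] := nbhs_apex U nU.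
have cN : compact (\bigcup_(n < N) (@piece _ Y n @` setT)).
  rewrite bigcup_mkord; apply: bigsetU_compact => n _.
  apply: continuous_compact (cY n).
  exact/continuous_subspaceT/piece_continuous.
have /compact_near_coveringP/(_ I F P FF (fun p _ => cov p Logic.I)) := cN.
apply: filter_app; apply: filterS FV => i Vi FP [[n y]|] _; last first.
  by apply: (UV (_, i)); split => //; exact: nbhs_singleton.
have [Nn|nN] := leqP N n.
  by apply: (UV (_, i)); split => //=; exact: (NU n).
by apply: FP; exists n => //; exists y.
Qed.

Definition pieces (A : forall n, set (Y n)) : set W :=
  [set p | if p is Some (existT n y) then A n y else True].

Lemma pieces_closed (A : forall n, set (Y n)) :
  (forall n, closed (A n)) -> closed (pieces A).
Proof.
move=> cA; rewrite -openC openE => -[[n y] nAy|/(_ Logic.I)//].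
have : open (~` A n) by rewrite openC.
rewrite openE => /(_ y nAy)/nbhs_mdistP[e /= e0 eA].
apply/(@nbhs_mdistP _ W (piece Y y)); exists (Num.min n.+1%:R^-1 e) => /=.
  by rewrite lt_min e0 invr_gt0 ltr0n.
move=> p /near_piece[|z -> yz]; first by rewrite ge_min lexx.
by apply: eA; rewrite /= (lt_le_trans yz)// ge_min lexx orbT.
Qed.

Context {X : metricType R} (x : X).

Definition null_glue (g : forall n, Y n -> X) (p : W) : X :=
  if p is Some (existT n y) then g n y else x.

(** On a piece the continuity is that of g n; at the apex it is the assumption
that g n tends to x uniformly on A n. *)
Lemma null_glue_continuous (A : forall n, set (Y n)) (g : forall n, Y n -> X) :
  (forall n, {within A n, continuous g n}) ->
  (forall e : R, 0 < e ->
    \forall n \near \oo, forall y, A n y -> mdist x (g n y) < e) ->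
  {within pieces A, continuous null_glue g}.
Proof.
move=> cg g0; apply/subspace_continuousP => -[[n y]|] Ap.
- have /subspace_continuousP/(_ y Ap)/cvgrPdist_lt gy := cg n.
  apply/cvgrPdist_lt => e /gy /nbhs_mdistP[d /= d0 dg].
  apply/(@nbhs_mdistP _ W (piece Y y)); exists (Num.min n.+1%:R^-1 d) => /=.
    by rewrite lt_min d0 invr_gt0 ltr0n.
  move=> p /near_piece[|z -> yz]; first by rewrite ge_min lexx.
  by apply: dg; rewrite /= (lt_le_trans yz)// ge_min lexx orbT.
- apply/cvgrPdist_lt => e e0; have [N _ NA] := g0 e e0.
  apply/(@nbhs_mdistP _ W (apex Y)); exists N.+1%:R^-1 => /=.
    by rewrite invr_gt0.
  move=> [[n y]|] /=; last by move=> _ _; rewrite mdistxx.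
  rewrite [X in X < _]mdist_apex_piece ltf_pV2 ?posrE// ltr_nat => Nn Ay.
  by apply: NA => //=; exact: ltnW.
Qed.
End null_union_topology.

(** * From e-openness to small extensions *)

(** A nonempty K sent into the open set O by the constant map forces O to be a
neighbourhood of x, so maps uniformly close to x send K into O as well. *)
Lemma cvg_const_map_space {R : realType} {Z : topologicalType}
    {X : metricType R} (x : X) (f : nat -> continuousType Z X) :
  (forall e : R, 0 < e -> \forall N \near \oo, forall z, mdist x (f N z) < e) ->
  (f : nat -> map_space Z X) @ \oo --> (cst x : map_space Z X).
Proof.
move=> fx U /= [_ [[V oV <-] Vx VU]].
apply: (filterS VU).
have /(_ V) : (fun N => f N : {compact-open, Z -> X}) @ \oo -->
    (cst x : {compact-open, Z -> X}).
  apply/compact_open_cvgP => K O cK oO KO.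
  have [->|/set0P[z Kz]] := eqVneq K set0.
    by apply: filterE => N /=; rewrite image_set0.
  have : nbhs x O.
    by apply: open_nbhs_nbhs; split => //; apply: KO; exists z.
  move=> /nbhs_mdistP[e /= e0 eO].
  apply: filterS (fx e e0) => N fN _ [u _ <-]; exact: (eO _ (fN u)).
by apply; exact: open_nbhs_nbhs.
Qed.

(** The local form of the theorem, where the size of a map is measured by the
distance of its values to a given point x.  The null union of a sequence of
counterexamples turns openness for one pair into uniformity over all pairs. *)
Lemma e_open_small_extension {R : realType} {X : metricType R} (x : X)
    (eta : R) : e_open R X -> 0 < eta ->
  exists2 delta : R, 0 < delta &
    forall (Y : metricType R) (Z : set Y), space_pair Z ->
    forall phi : continuousType Z X, (forall z, mdist x (phi z) < delta) ->
    exists2 g : continuousType Y X,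
      extends g phi & forall y, mdist x (g y) < eta.
Proof.
move=> Xe eta0; apply: contrapT => noext.
pose good (Y : metricType R) (Z : set Y) (phi : continuousType Z X) :=
  exists2 g : continuousType Y X, extends g phi & forall y, mdist x (g y) < eta.
have bad (n : nat) :
  exists t : {Y : metricType R & {Z : set Y & continuousType Z X}},
    [/\ space_pair (projT1 (projT2 t)),
        forall z, mdist x (projT2 (projT2 t) z) < n.+1%:R^-1 &
        ~ good _ _ (projT2 (projT2 t))].
  apply: contrapT => nbad; apply: noext; exists n.+1%:R^-1.
    by rewrite invr_gt0 ltr0n.
  move=> Y Z YZ phi phix; apply: contrapT => ng; apply: nbad.
  by exists (existT _ Y (existT _ Z phi)).
have [t {bad}bad] := choice bad.
pose Y n := projT1 (t n).
pose Z n : set (Y n) := projT1 (projT2 (t n)).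
pose phi n : continuousType (Z n) X := projT2 (projT2 (t n)).
have YZ n : space_pair (Z n) by have [] := bad n.
have phix n z : mdist x (phi n z) < n.+1%:R^-1 by have [] := bad n.
have nphi n : ~ good _ _ (phi n) by have [] := bad n.
(* The sequence of bad pairs is made abstract, so that only the facts about it
that have just been extracted remain. *)
move: Y Z phi YZ phix nphi => {noext t bad} Y Z phi YZ phix nphi.
pose W := null_union Y.
have WZ : space_pair (pieces Y Z).
  split; first by apply: null_union_compact => n; case: (YZ n).
  by apply: pieces_closed => n; case: (YZ n).
(* The gluing needs functions on all of Y n; outside of Z n the value x of psi n
is a mere default. *)
pose psi n : Y n -> X := valL_ x (phi n).
have psiE n (z : Z n) : psi n (val z) = phi n z.
  exact: (congr1 (@^~ z) (valLK x (phi n))).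
have psix n y : Z n y -> mdist x (psi n y) < n.+1%:R^-1.
  by move=> /mem_set Zy; rewrite (psiE n (SigSub Zy)).
pose tail N n : Y n -> X := if (N <= n)%N then psi n else cst x.
have tail_cts N n : {within Z n, continuous tail N n}.
  rewrite /tail; case: ifP => _; last exact/continuous_subspaceT/cst_continuous.
  by apply/subspace_valL_continuousP'; exact: cts_fun.
have tail_close e N n y : n.+1%:R^-1 < e -> Z n y -> mdist x (tail N n y) < e.
  rewrite /tail => ne; case: ifP => _ Zy.
    exact: lt_trans (psix _ _ Zy) ne.
  by rewrite mdistxx (lt_trans _ ne)// invr_gt0.
have glue_cts N : continuous (sigL (pieces Y Z) (null_glue Y x (tail N))).
  apply/subspace_sigL_continuousP; apply: null_glue_continuous => // e e0.
  apply: filterS (near_infty_natSinv_lt (PosNum e0)) => n ne y Zy.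
  exact: tail_close.
pose f N : continuousType (pieces Y Z) X := mkcts (glue_cts N).
have : (f : nat -> map_space (pieces Y Z) X) @ \oo --> (cst x : map_space _ X).
  apply: cvg_const_map_space => e e0.
  have [M _ Me] := near_infty_natSinv_lt (PosNum e0); exists M => // N /= MN.
  move=> p; rewrite -[f N p]/(null_glue Y x (tail N) (val p)).
  have := set_valP p; case: (val p) => [[n y]|] /= Zp; last by rewrite mdistxx.
  rewrite /tail; case: ifP => [Nn|_]; last by rewrite mdistxx.
  by apply: lt_trans (psix _ _ Zp) _; apply: Me; exact: leq_trans Nn.
move=> /(_ (@extendable_maps W X (pieces Y Z)))[].
  by apply: open_nbhs_nbhs; split; [exact: Xe|exists (cst x)].
move=> N _ /(_ N (leqnn N))[G Gf].
have : nbhs (apex Y) (fun p => mdist x (G p) < eta).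
  have GA : G (apex Y) = x.
    have apexZ : apex Y \in pieces Y Z by rewrite inE.
    exact: (Gf (SigSub apexZ)).
  rewrite -GA.
  exact: (@cvgr_dist_lt _ _ _ _ _ G _ (@cts_fun _ _ G (apex Y))).
move=> /nbhs_apex[M _ MG].
(* Past M the map G is small on the pieces, past N it restricts to phi n. *)
pose n := maxn M N.
apply: (nphi n); exists (G \o mkcts (@piece_continuous _ Y n)).
- move=> z.
  have pZ : piece Y (val z) \in pieces Y Z by rewrite inE; exact: set_valP.
  rewrite -psiE; apply: etrans (Gf (SigSub pZ)) _.
  by rewrite -[f N _]/(tail N n (val z)) /tail leq_maxr.
- by move=> y; apply: MG; exact: leq_maxl.
Qed.

Theorem theorem4p1 (R : realType) (X : metricType R)
    (X_nonempty : [set: X] !=set0) (X_compact : compact [set: X])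
    (X_e_open : e_open R X) (epsilon : R) (epsilon_gt0 : 0 < epsilon) :
  exists2 delta : R, 0 < delta &
    forall (Y : metricType R) (Z : set Y), space_pair Z ->
    forall phi : continuousType Z X, (diam (range phi) < delta%:E)%E ->
    exists2 phibar : continuousType Y X,
      extends phibar phi & (diam (range phibar) < epsilon%:E)%E.
Proof.
(* Values within eta of x have diameter at most 2 eta = epsilon / 2. *)
pose eta := epsilon / 4.
have eta0 : 0 < eta by rewrite divr_gt0.
have diam_small (Y : metricType R) (g : Y -> X) (x : X) :
    (forall y, mdist x (g y) < eta) -> (diam (range g) < epsilon%:E)%E.
  move=> gx; apply: (@le_lt_trans _ _ (eta + eta)%:E).
    apply: ge_ereal_sup => _ [[_ _] /= [[y _ <-] [z _ <-]] <-].
    rewrite lee_fin (le_trans (metric_triangle _ x _))// metric_sym.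
    by rewrite lerD// ltW.
  by rewrite lte_fin /eta; lra.
pose good (delta : R) (x : X) := forall (Y : metricType R) (Z : set Y),
  space_pair Z -> forall phi : continuousType Z X,
  (forall z, mdist x (phi z) < delta) ->
  exists2 g : continuousType Y X,
    extends g phi & (diam (range g) < epsilon%:E)%E.
have : \forall delta \near 0^'+, [set: X] `<=` good delta.
  move/compact_near_coveringP: X_compact; apply => x _.
  have [delta delta0 ext] := e_open_small_extension x eta X_e_open eta0.
  (* Half of the bound is spent on moving the center from x to x', half on the
  distance of the values to x'. *)
  exists (ball x (delta / 2), [set d : R | d < delta / 2]).
    split; first by apply: nbhsx_ballx; rewrite divr_gt0.
    by apply: nbhs_right_lt; rewrite divr_gt0.
  move=> [x' d] [/= xx' dd] Y Z YZ phi phix'.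
  move: xx'; rewrite ballEmdist /= => xx'.
  have [z|g gphi gx] := ext Y Z YZ phi.
    rewrite (le_lt_trans (metric_triangle _ x' _))// (splitr delta) ltrD//.
    exact: lt_trans (phix' z) dd.
  by exists g => //; exact: diam_small gx.
move=> good_near; near (0 : R)^'+ => delta.
have delta0 : 0 < delta by [].
have gd : [set: X] `<=` good delta by near: delta.
exists delta => // Y Z YZ phi phid.
have [[z0 _]|noZ] := pselect (exists z : Z, True).
  apply: (gd (phi z0)) => // z.
  rewrite -lte_fin (le_lt_trans _ phid)//.
  by apply: ereal_sup_ubound; exists (phi z0, phi z).
(* When Z is empty, so is phi: any point of X can serve as a center. *)
have [x0 _] := X_nonempty.
by apply: (gd x0) => // z; case: noZ; exists z.
Unshelve. all: by end_near. Qed.
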